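(* Let $q=p^m$ be a power of a prime $p$, let $w_1\ge w_2\ge 1$ be integers with $w_1\ge 2$, let $r_i=[\log_p w_i]$ for $i=1,2$, and let $k=\lceil (q-1)/(w_1w_2)\rceil+1$ (with $k\le q-1$). Suppose that $k-1$ divides $q$, with $q/(k-1)=p^s$, and that $$s\le r_1+r_2\quad\text{or}\quad [w_1/p^{r_1}]\cdot[w_2/p^{r_2}]\ge p.$$ If $\mathrm{RS}_k(q)$ is a $(w_1,w_2)$-separating code, then $d>n-n/(w_1w_2)$, where $n=q-1$ is the length and $d$ is the minimum distance of $\mathrm{RS}_k(q)$.
   Context: $[x]$ denotes the integer part (floor) of $x$. For an integer $1\le k\le q-1$, the Reed-Solomon code of dimension $k$ over $\mathbb{F}_q$ is $\mathrm{RS}_k(q)=\{ev(f)\mid f\in\mathbb{F}_q[x],\ \deg f<k\}$, where $ev(f)=(f(\alpha^0),f(\alpha^1),\dots,f(\alpha^{q-2}))\in\mathbb{F}_q^{q-1}$ and $\alpha$ is a primitive element of $\mathbb{F}_q$. It is a $[q-1,k,q-k]$-linear code. For a nonempty subset $U$ of a code $C\subset\mathbb{F}_q^n$, its descendant set is $\mathrm{desc}\,U=\{x\in\mathbb{F}_q^n\mid \forall i\ \exists y\in U:\ x_i=y_i\}$. The code $C$ is $(w_1,w_2)$-separating if, whenever $U_1,U_2$ are disjoint subsets of $C$ with $1\le|U_1|\le w_1$ and $1\le|U_2|\le w_2$, the sets $\mathrm{desc}\,U_1$ and $\mathrm{desc}\,U_2$ are disjoint. *)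

(* Defs.v *)
From mathcomp Require Import all_boot all_order all_algebra.

Set Implicit Arguments.
Unset Strict Implicit.
Unset Printing Implicit Defensive.

Import GRing.Theory.
Local Open Scope ring_scope.

Section Codes.
Variables (F : finFieldType) (n : nat).
Implicit Types (x y : 'rV[F]_n) (C U : {set 'rV[F]_n}).

Definition hamming_dist x y : nat := #|[set i : 'I_n | x 0 i != y 0 i]|.

(* All distances are at most [n], so the default value [n] only matters for
   codes with fewer than two words. *)
Definition min_dist C : nat :=
  \big[minn/n]_(x in C) \big[minn/n]_(y in C | x != y) hamming_dist x y.

Definition desc U : {set 'rV[F]_n} :=
  [set x : 'rV[F]_n | [forall i, exists y in U, x 0 i == y 0 i]].

Definition separating (w1 w2 : nat) C : Prop :=
  forall U1 U2 : {set 'rV[F]_n}, U1 \subset C -> U2 \subset C -> [disjoint U1 & U2] ->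
    (1 <= #|U1| <= w1)%N -> (1 <= #|U2| <= w2)%N ->
    [disjoint desc U1 & desc U2].

End Codes.

Section ReedSolomon.
Variables (F : finFieldType) (alpha : F).

Definition rs_ev (f : {poly F}) : 'rV[F]_(#|F|.-1) :=
  \row_(i < #|F|.-1) f.[alpha ^+ i].

(* [{poly_k F}] is the type of polynomials of size at most [k], that is, of
   degree less than [k] (including 0). *)
Definition RS (k : nat) : {set 'rV[F]_(#|F|.-1)} :=
  [set rs_ev (polyn f) | f : {poly_k F}].

End ReedSolomon.

(* Main.v *)
(** Since k - 1 = ceil(n/(w1 w2)), the inequality d > n - n/(w1 w2) always
    fails, so one has to show that RS_k(q) is never (w1, w2)-separating.  Let
    k - 1 = p^t.  Take a monic additive polynomial P of degree p^t vanishing on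
    t elements of an F_p-basis of F: its values lie in the F_p-span of the s
    images of the other basis elements.  The hypothesis on s lets one cover
    this span by a sumset A + B with |A| <= w1 and |B| <= w2.  Then
    U1 = {ev(P - a) | a in A} and U2 = {ev(b) | b in B} are disjoint, but at
    each point of F some P - a agrees with some b, so a common descendant
    exists. *)
Require Import Defs.
From mathcomp Require Import all_boot all_order all_algebra.
From mathcomp Require Import all_field.
From mathcomp Require Import zify.

Set Implicit Arguments.
Unset Strict Implicit.
Unset Printing Implicit Defensive.

Import Order.TTheory GRing.Theory Num.Theory.
Local Open Scope ring_scope.

Section DigitSpan.
Variables (V : finZmodType) (p : nat).
Implicit Types (x : V) (l : seq V).

(** In characteristic [p] this is the F_p-span of [l]. Natural-number multiples serve as scalars, so
    [V] only has to be an additive group. *)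
Fixpoint digit_span l : {set V} :=
  if l is g :: l' then [set x + g *+ val j | x in digit_span l', j in [set: 'I_p]]
  else [set 0].

Lemma card_sum_multiples (D : {set V}) (g : V) (a : nat) :
  (#|[set (x + g *+ val j)%R | x in D, j in [set: 'I_a]]| <= a * #|D|)%N.
Proof.
rewrite curry_imset2X; apply: leq_trans (leq_imset_card _ _) _.
by rewrite cardsX cardsT card_ord mulnC.
Qed.

Lemma card_digit_span l : (#|digit_span l| <= p ^ size l)%N.
Proof.
elim: l => [|g l IH] /=; first by rewrite cards1.
by rewrite (leq_trans (card_sum_multiples _ _ _)) // expnS leq_mul2l IH orbT.
Qed.

Lemma mem_digit_span l (c : nat -> nat) :
  (forall i, (c i < p)%N) -> \sum_(i < size l) l`_i *+ c i \in digit_span l.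
Proof.
elim: l c => [|g l IH] c cp; first by rewrite big_ord0 inE.
rewrite /= big_ord_recl addrC; apply/imset2P.
exists (\sum_(i < size l) l`_i *+ c i.+1) (Ordinal (cp 0%N)); rewrite ?inE //.
by apply: (IH (fun i => c i.+1)).
Qed.

Lemma digit_span_cat l1 l2 x : x \in digit_span (l1 ++ l2) ->
  exists y z, [/\ y \in digit_span l1, z \in digit_span l2 & x = y + z].
Proof.
elim: l1 x => [|g l1 IH] x /=.
  by exists 0, x; rewrite inE add0r.
case/imset2P=> u j /IH[y [z [yl zl ->]]] _ ->.
exists (y + g *+ val j), z; split=> //; last by rewrite addrAC.
by apply/imset2P; exists y j; rewrite ?inE.
Qed.

Lemma digit_span_zeros l : all (pred1 0) l -> digit_span l \subset [set 0].
Proof.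
elim: l => //= g l IH /andP[/eqP-> /IH/subsetP sl].
apply/subsetP=> x /imset2P[y j /sl]; rewrite inE => /eqP-> _ ->.
by rewrite mul0rn addr0 inE.
Qed.

Lemma digit_span_map (f : V -> V) l x :
  {morph f : y z / y + z} -> x \in digit_span l -> f x \in digit_span (map f l).
Proof.
move=> fD; have f0 : f 0 = 0 by apply: (addrI (f 0)); rewrite -fD !addr0.
have fMn y n : f (y *+ n) = f y *+ n.
  by elim: n => [|n IH]; rewrite ?mulr0n // !mulrS fD IH.
elim: l x => [|g l IH] x /=; first by rewrite !inE => /eqP->; rewrite f0.
case/imset2P=> y j yl _ ->; apply/imset2P; exists (f y) j; rewrite ?inE //; first exact: IH.
by rewrite fD fMn.
Qed.

(* With one generator [v] beyond [r1 + r2], the digits [j < p] of [v] are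
   written in base [a1]: the unit digit goes to [A], the other one to [B]. *)
Lemma digit_span_cover l r1 r2 a1 a2 :
    (0 < p)%N -> (0 < a1)%N -> (0 < a2)%N ->
    (size l <= r1 + r2)%N \/ size l = (r1 + r2).+1 /\ (p <= a1 * a2)%N ->
  exists A B : {set V}, [/\ (#|A| <= a1 * p ^ r1)%N, (#|B| <= a2 * p ^ r2)%N &
    {in digit_span l, forall x, exists y z, [/\ y \in A, z \in B & x = y + z]}].
Proof.
move=> p0 a10 a20 [sl|[sl pa]].
  (* Without an extra generator, the first [r1] generators span [A] and the at most [r2] others span
     [B]; the factors [a1] and [a2] are slack. *)
  exists (digit_span (take r1 l)), (digit_span (drop r1 l)); split.
  - apply: leq_trans (card_digit_span _) _; apply: leq_trans (leq_pmull _ a10).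
    by rewrite leq_pexp2l // size_take_min geq_minl.
  - apply: leq_trans (card_digit_span _) _; apply: leq_trans (leq_pmull _ a20).
    by rewrite leq_pexp2l // size_drop leq_subLR.
  - by move=> x; rewrite -{1}(cat_take_drop r1 l) => /digit_span_cat.
case: l sl => // v l [sl].
exists [set x + v *+ val j | x in digit_span (take r1 l), j in [set: 'I_a1]].
exists [set x + v *+ a1 *+ val j | x in digit_span (drop r1 l), j in [set: 'I_a2]].
split.
- apply: leq_trans (card_sum_multiples _ _ _) _; rewrite leq_mul2l.
  rewrite (leq_trans (card_digit_span _)) ?orbT //.
  by rewrite leq_pexp2l // size_take_min geq_minl.
- apply: leq_trans (card_sum_multiples _ _ _) _; rewrite leq_mul2l.
  rewrite (leq_trans (card_digit_span _)) ?orbT //.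
  by rewrite leq_pexp2l // size_drop leq_subLR sl.
move=> x /imset2P[u j ul _ ->].
have /digit_span_cat[y [z [yl zl ->]]] :
  u \in digit_span (take r1 l ++ drop r1 l) by rewrite cat_take_drop.
have lt1 : (j %% a1 < a1)%N by rewrite ltn_mod.
have lt2 : (j %/ a1 < a2)%N.
  by rewrite ltn_divLR // mulnC (leq_trans (ltn_ord j)).
exists (y + v *+ (j %% a1)), (z + v *+ a1 *+ (j %/ a1)); split.
- by apply/imset2P; exists y (Ordinal lt1); rewrite ?inE.
- by apply/imset2P; exists z (Ordinal lt2); rewrite ?inE.
by rewrite -mulrnA addrACA -mulrnDr [(a1 * _)%N]mulnC addnC -divn_eq.
Qed.

End DigitSpan.

(** Over its prime field, [F] has dimension [m]; the coordinates in a basis are residues below [p],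
    hence digits. *)
Lemma digit_span_full (F : finFieldType) (p m : nat) :
  prime p -> #|F| = (p ^ m)%N ->
  exists2 l : seq F, size l = m & digit_span p l = [set: F].
Proof.
move=> pr_p qE; have chp : p \in [pchar F] := card_finPcharP qE pr_p.
pose Rp := pPrimeCharType chp; pose L : {vspace Rp} := fullv.
have dimL : \dim L = m by rewrite pprimeChar_dimf /= qE pfactorK.
pose l : seq Rp := vbasis L.
have sl : size l = \dim L by rewrite size_tuple.
exists l; first by rewrite sl.
apply/setP=> x; rewrite inE.
(* The value 0 outside the index range makes [c] total and bounded by [p] everywhere, as
   [mem_digit_span] asks. *)
pose c i := if insub i is Some j then val (coord (vbasis L) j (x : Rp)) else 0%N.
have cp i : (c i < p)%N.
  rewrite /c; case: insubP => [j _ _|_]; last exact: prime_gt0.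
  by apply: leq_trans (ltn_ord _) _; rewrite Fp_cast.
have := mem_digit_span l cp; rewrite sl.
suff -> : \sum_(i < \dim L) (l : seq F)`_i *+ c i = x by [].
rewrite [RHS](coord_vbasis (memvf (x : Rp))); apply: eq_bigr => i _.
by rewrite /c valK [RHS]mulr_natl.
Qed.

(* Adjoining a root [e] replaces [P] by [P^p - P(e)^(p-1) P]; the degree is the
   same whether or not [P(e)] is already zero. *)
Lemma linearized_poly_exists (F : fieldType) (p : nat) (l : seq F) :
  p \in [pchar F] ->
  exists P : {poly F}, [/\ size P = (p ^ size l).+1,
    {morph horner P : x y / x + y} & all (root P) l].
Proof.
move=> chp; have p_gt1 := prime_gt1 (pcharf_prime chp).
elim: l => [|e l [P [szP PD Pl]]].
  by exists 'X; rewrite size_polyX; split=> // x y; rewrite !hornerX.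
exists (P ^+ p - P.[e] ^+ p.-1 *: P); split=> /=.
- have szPp : size (P ^+ p) = (p ^ (size l).+1).+1.
    have := size_exp P p; rewrite szP /= -expnSr => <-.
    by rewrite prednK // size_poly_gt0 expf_neq0 // -size_poly_gt0 szP.
  rewrite size_polyDl // szPp size_polyN ltnS.
  apply: leq_trans (size_scale_leq _ _) _; rewrite szP.
  by rewrite ltn_exp2l.
- move=> x y; rewrite !(hornerD, hornerN, hornerZ, horner_exp) PD.
  rewrite -!(pFrobenius_autE chp) pFrobenius_autD_comm; last exact: mulrC.
  by rewrite mulrDr opprD addrACA.
- apply/andP; split.
    by rewrite /root !hornerE -exprSr prednK ?subrr // ltnW.
  apply/allP=> x /(allP Pl)/rootP Px.
  by rewrite /root !hornerE Px expr0n mulr0 subr0 -(prednK (ltnW p_gt1)).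
Qed.

(** The two word sets are disjoint because P - y - z is nonconstant of degree less than n, so it
    cannot vanish at all n powers of [alpha]. The covering of the values of [P] then provides the
    common descendant. *)
Lemma RS_not_separating (F : finFieldType) (alpha : F) (k w1 w2 : nat)
    (P : {poly F}) (A B : {set F}) :
  (#|F|.-1).-primitive_root alpha ->
  (1 < size P <= k)%N -> (size P <= #|F|.-1)%N ->
  (#|A| <= w1)%N -> (#|B| <= w2)%N ->
  (forall x, exists y z, [/\ y \in A, z \in B & P.[x] = y + z]) ->
  ~ separating w1 w2 (RS alpha k).
Proof.
move=> prim /andP[szP1 szPk] szPn cA cB cov sep.
have ev_RS (f : {poly F}) : (size f <= k)%N -> rs_ev alpha f \in RS alpha k.
  by move=> sf; apply/imsetP; exists (npolyp k f) => //; rewrite npolypK.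
have szPC c : size (P - c%:P) = size P.
  by rewrite size_polyDl // size_polyN (leq_ltn_trans (size_polyC_leq1 _)).
have szC (c : F) : (size c%:P <= k)%N.
  by rewrite (leq_trans (size_polyC_leq1 _)) // (leq_trans _ szPk) // ltnW.
(* Any point would do here: this only shows that [A] and [B], hence [U1] and [U2], are nonempty. *)
have [y0 [z0 [y0A z0B _]]] := cov 0.
pose U1 := [set rs_ev alpha (P - y%:P) | y in A].
pose U2 := [set rs_ev alpha z%:P | z in B].
have dU : [disjoint U1 & U2].
  apply/pred0P=> x /=; apply/negP=> /andP[/imsetP[y _ ->] /imsetP[z _]] evE.
  have szPyz : size (P - y%:P - z%:P) = size P.
    by rewrite -addrA -opprD -polyCD szPC.
  have : (size [seq (alpha ^+ i)%R | i <- iota 0 #|F|.-1] <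
          size (P - y%:P - z%:P)%R)%N.
    apply: max_poly_roots.
    - by rewrite -size_poly_gt0 szPyz ltnW.
    - apply/allP=> _ /mapP[i ilt ->]; move: ilt; rewrite mem_iota => /= ilt.
      have /rowP/(_ (Ordinal ilt)) := evE; rewrite !mxE /= !hornerE => e.
      by rewrite /root !hornerE e subrr.
    - rewrite map_inj_in_uniq ?iota_uniq // => i j; rewrite !mem_iota /= => ilt jlt.
      by move/eqP; rewrite (eq_prim_root_expr prim) !modn_small // => /eqP.
  by rewrite size_map size_iota szPyz ltnNge szPn.
have : [disjoint desc U1 & desc U2].
  apply: sep => //.
  - by apply/subsetP=> _ /imsetP[y _ ->]; rewrite ev_RS ?szPC.
  - by apply/subsetP=> _ /imsetP[z _ ->]; rewrite ev_RS.
  - rewrite (leq_trans (leq_imset_card _ _)) // andbT.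
    by apply/card_gt0P; exists (rs_ev alpha (P - y0%:P)); apply: imset_f.
  - rewrite (leq_trans (leq_imset_card _ _)) // andbT.
    by apply/card_gt0P; exists (rs_ev alpha z0%:P); apply: imset_f.
have [y yP] := fin_all_exists (fun i : 'I_(#|F|.-1) => cov (alpha ^+ i)).
have [z zP] := fin_all_exists yP.
(* The common descendant takes at position i the summand in [B] of the value of [P] there; it equals
   that value minus the summand in [A]. *)
move/pred0P/(_ (\row_i z i)) => /negbT /negP[] /=; apply/andP; split.
  rewrite inE; apply/forallP=> i; apply/existsP; have [yA _ Pyz] := zP i.
  exists (rs_ev alpha (P - (y i)%:P)); rewrite imset_f //= !mxE !hornerE Pyz.
  by rewrite addrC addKr.
rewrite inE; apply/forallP=> i; apply/existsP; have [_ zB _] := zP i.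
by exists (rs_ev alpha (z i)%:P); rewrite imset_f //= !mxE !hornerE.
Qed.

Theorem theorem3p1 (F : finFieldType) (p m : nat) (alpha : F)
    (w1 w2 k s : nat) :
  let q := #|F| in
  let n := q.-1 in
  let r1 := trunc_log p w1 in
  let r2 := trunc_log p w2 in
  prime p ->
  q = (p ^ m)%N ->
  n.-primitive_root alpha ->
  (1 <= w2)%N -> (w2 <= w1)%N -> (2 <= w1)%N ->
  k%:Z = Num.ceil (n%:R / (w1 * w2)%:R : rat) + 1 ->
  (k <= q.-1)%N ->
  (k.-1 %| q)%N ->
  (q %/ k.-1 = p ^ s)%N ->
  (s <= r1 + r2)%N \/ (p <= (w1 %/ p ^ r1) * (w2 %/ p ^ r2))%N ->
  separating w1 w2 (RS alpha k) ->
  n%:R - n%:R / (w1 * w2)%:R < (min_dist (RS alpha k))%:R :> rat.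
Proof.
move=> q n r1 r2 pr_p qE prim w2_gt0 le_w w1_gt1 kE kn kq qk hs sep.
have p_gt1 := prime_gt1 pr_p; have p_gt0 := ltnW p_gt1.
have w1_gt0 := ltnW w1_gt1.
have n_gt0 : (0 < n)%N := prim_order_gt0 prim.
have q_gt0 : (0 < q)%N by rewrite (leq_trans n_gt0) ?leq_pred.
have K_gt0 := dvdn_gt0 q_gt0 kq.
have [t _ KE] : exists2 t, (t <= m)%N & k.-1 = (p ^ t)%N.
  by apply/dvdn_pfactor; rewrite // -qE.
have qKs : q = (k.-1 * p ^ s)%N by rewrite -qk mulnC divnK.
have mE : m = (t + s)%N.
  by apply/eqP; rewrite -(eqn_exp2l _ _ p_gt1) expnD -qE -KE -qKs.
(* [k.-1] is the ceiling of n/(w1 w2). *)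
have n_le : (n <= k.-1 * (w1 * w2))%N.
  have w12 : 0 < (w1 * w2)%:R :> rat by rewrite ltr0n muln_gt0 w1_gt0.
  have := Num.Theory.ceil_ge (n%:R / (w1 * w2)%:R : rat).
  have -> : Num.ceil (n%:R / (w1 * w2)%:R : rat) = k.-1%:Z by lia.
  by rewrite ler_pdivrMr // -pmulrn -natrM ler_nat.
have lt1 := trunc_log_ltn w1 p_gt1; have lt2 := trunc_log_ltn w2 p_gt1.
rewrite -/r1 -/r2 in lt1 lt2.
(* If [s >= r1 + r2 + 2] then [p^s] exceeds [w1 w2] by at least 3, as
   [w_i <= p^(r_i+1) - 1]; but [(k-1) p^s = n + 1 <= (k-1) w1 w2 + 1]. *)
have s_le : (s <= (r1 + r2).+1)%N.
  rewrite leqNgt; apply/negP => s_gt.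
  have le_s : (p ^ r1.+1 * p ^ r2.+1 <= p ^ s)%N.
    by rewrite -expnD leq_pexp2l // addSn addnS.
  have g1 : (2 <= p ^ r1.+1)%N by rewrite (leq_trans p_gt1) // -{1}(expn1 p) leq_pexp2l.
  have g2 : (2 <= p ^ r2.+1)%N by rewrite (leq_trans p_gt1) // -{1}(expn1 p) leq_pexp2l.
  have w12 : (w1 * w2 + 3 <= p ^ s)%N by apply: leq_trans le_s; nia.
  have := leq_mul (leqnn k.-1) w12; rewrite -qKs.
  move: n_le; rewrite /n; lia.
have [l szl lF] := digit_span_full pr_p qE.
have chp : p \in [pchar F] := card_finPcharP qE pr_p.
have [P [szP PD Pl]] := linearized_poly_exists (take t l) chp.
rewrite size_takel -?KE in szP; last by rewrite szl mE leq_addr.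
pose gs := map (horner P) (drop t l).
have szgs : size gs = s by rewrite size_map size_drop szl mE addKn.
have Pgs x : P.[x] \in digit_span p gs.
  have /(digit_span_map PD) : x \in digit_span p l by rewrite lF inE.
  rewrite -[X in map _ X](cat_take_drop t) map_cat.
  case/digit_span_cat=> y [z [yl zl ->]].
  have /digit_span_zeros/subsetP/(_ y yl): all (pred1 0) (map (horner P) (take t l)).
    by rewrite all_map.
  by rewrite inE => /eqP->; rewrite add0r.
have pr1 : (p ^ r1 <= w1)%N by apply: trunc_logP.
have pr2 : (p ^ r2 <= w2)%N by apply: trunc_logP.
(* The quotients are the leading base-[p] digits of [w1] and [w2]: they are positive, and
   multiplying them back by the powers of [p] stays within [w1] and [w2]. *)
have [||||A [B [cA cB AB]]] := @digit_span_cover F p gs r1 r2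
  (w1 %/ p ^ r1) (w2 %/ p ^ r2).
- by [].
- by rewrite divn_gt0 // expn_gt0 p_gt0.
- by rewrite divn_gt0 // expn_gt0 p_gt0.
(* By [s_le], the only other case is s = r1 + r2 + 1, where [hs] must supply the digit product
   bound. *)
- rewrite szgs; case: (leqP s (r1 + r2)) => [|s_gt]; first by left.
  right; split; first by apply/eqP; rewrite eqn_leq s_le.
  by case: hs => //; rewrite leqNgt s_gt.
(* As deg P = p^t = k - 1, [size P] is exactly [k], the largest size the code admits. The goal
   follows from the contradiction with [sep]. *)
case: (@RS_not_separating F alpha k w1 w2 P A B) => //.
- by rewrite szP; lia.
- by rewrite szP; lia.
- by rewrite (leq_trans cA) // leq_trunc_div.
- by rewrite (leq_trans cB) // leq_trunc_div.
- by move=> x; apply: AB.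
Qed.
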